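(* Let $\Lambda_0>0$, $\alpha>0$, $\gamma>0$, $\beta\in(0,1)$ and $\nu>0$, with $(\alpha-1)\gamma+\nu^\beta\neq0$. Let $(N(t))_{t\ge0}$ be the Hawkes process with (time-rescaled) tempered Mittag-Leffler kernel, with expected intensity $\lambda$ having Laplace transform $$\tilde{\lambda}(s)=\frac{\Lambda_0}{s}\left[\frac{\gamma-\nu^\beta+(\nu+s)^\beta}{\gamma(1-\alpha)-\nu^\beta+(\nu+s)^\beta}\right].$$ Then for every $t\ge 0$ the expected number of events up to time $t$ is $$\mathbb{E}[N(t)]=\Lambda_0\left[\frac{\nu^\beta-\gamma}{(\alpha-1)\gamma+\nu^\beta}\,t+\frac{\alpha\gamma e^{-\nu t}}{(\alpha-1)\gamma+\nu^\beta}\sum_{m=0}^\infty\sum_{n=0}^\infty\nu^{n+m}t^{m+n+1}M^1_{\beta,m+n+2}\big(((\alpha-1)\gamma+\nu^\beta)t^\beta\big)\right].$$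
   Context: For $a,b,c\in\mathbb{C}$ with positive real parts, the generalized Mittag-Leffler function is $M^c_{a,b}(z)=\sum_{n=0}^\infty \frac{(c)_n}{\Gamma(an+b)}\frac{z^n}{n!}$, where $(c)_n$ is the Pochhammer symbol; thus $M^1_{a,b}(z)=\sum_{n=0}^\infty\frac{z^n}{\Gamma(an+b)}$. A Hawkes process is a counting process $(N(t))_{t\ge0}$ with history $\mathcal{H}_t$ such that, given $\mathcal{H}_t$, $N(t+h)-N(t)$ equals $1$ with probability $\Lambda(t|\mathcal{H}_t)h+o(h)$, $0$ with probability $1-\Lambda(t|\mathcal{H}_t)h+o(h)$, and $n\ge2$ with probability $o(h)$, where $\Lambda(t|\mathcal{H}_t)=\Lambda_0+\alpha\int_0^t f(t-u)\,dN(u)$. Here $\Lambda_0$ is the baseline intensity, $\alpha$ the jump size and $f$ the kernel density. The kernel $f$ is the tempered Mittag-Leffler density with time scale changed by the factor $\gamma$, i.e. with Laplace transform $\int_0^\infty e^{-st}f(t)\,dt=\frac{\gamma}{\gamma-\nu^\beta+(\nu+s)^\beta}$. The expected intensity is $\lambda(t)=\mathbb{E}[\Lambda(t|\mathcal{H}_t)]$, which is the continuous function on $[0,\infty)$ whose Laplace transform is the displayed $\tilde\lambda(s)$ (for all $s$ of sufficiently large real part), and $\mathbb{E}[N(t)]=\int_0^t\lambda(u)\,du$. *)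

(* Defs.v *)
From HB Require Import structures.
From mathcomp Require Import all_boot all_order all_algebra.
From mathcomp Require Import all_classical all_reals all_analysis.
From mathcomp Require Export complex.

Set Implicit Arguments.
Unset Strict Implicit.
Unset Printing Implicit Defensive.

Import Order.TTheory GRing.Theory Num.Theory.
Import numFieldNormedType.Exports.

Local Open Scope classical_set_scope.
Local Open Scope ring_scope.
Local Open Scope complex_scope.

(* Principal argument in ]-pi, pi]. *)
Definition carg (R : realType) (z : R[i]) : R :=
  let: x +i* y := z in
  let a := acos (x / Num.sqrt (x ^+ 2 + y ^+ 2)) in
  if 0 <= y then a else - a.

Definition cexp (R : realType) (z : R[i]) : R[i] :=
  let: x +i* y := z in (expR x * cos y) +i* (expR x * sin y).

(* Principal branch; only meaningful for z != 0. *)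
Definition clog (R : realType) (z : R[i]) : R[i] :=
  let: x +i* y := z in ln (Num.sqrt (x ^+ 2 + y ^+ 2)) +i* carg z.

Definition cpow (R : realType) (z : R[i]) (b : R) : R[i] :=
  cexp (b%:C * clog z).

(* Re(s) lies in the half-plane of absolute convergence:
   |e^{-st} g(t)| = e^{- Re(s) t} |g(t)|. *)
Definition laplace_integrable (R : realType) (g : R -> R) (s : R[i]) : Prop :=
  (@lebesgue_measure R).-integrable `[0, +oo[
    (fun t => (expR (- (complex.Re s * t)) * g t)%:E).

Definition laplace (R : realType) (g : R -> R) (s : R[i]) : R[i] :=
  (\int[@lebesgue_measure R]_(t in `[0, +oo[)
      complex.Re (cexp (- (s * t%:C)) * (g t)%:C))
  +i*
  (\int[@lebesgue_measure R]_(t in `[0, +oo[)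
      complex.Im (cexp (- (s * t%:C)) * (g t)%:C)).

Definition Gamma (R : realType) (x : R) : R :=
  \int[@lebesgue_measure R]_(u in `]0, +oo[) (u `^ (x - 1) * expR (- u)).

Definition pochhammer (R : realType) (c : R) (n : nat) : R :=
  \prod_(i < n) (c + i%:R).

(* Summand and sum of M^c_{a,b}(z), for real parameters and argument. *)
Definition mittag_leffler_term (R : realType) (c a b z : R) (n : nat) : R :=
  pochhammer c n / Gamma (a * n%:R + b) * (z ^+ n / n`!%:R).

Definition mittag_leffler (R : realType) (c a b z : R) : R :=
  limn (series (mittag_leffler_term c a b z)).

(* Density on the positive half-line of the tempered Mittag-Leffler law with
   time rescaled by g; such a density is determined by its Laplace transform
   up to a null set, and its value at 0 (where it is singular) is irrelevant. *)
Definition tempered_ML_kernel (R : realType) (g beta nu : R) (f : R -> R) :=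
  [/\ measurable_fun (`]0, +oo[ : set R) f,
      forall t, 0 < t -> 0 <= f t &
      forall s : R[i], 0 <= complex.Re s ->
        laplace_integrable f s /\
        laplace f s =
          g%:C / (g%:C - (nu `^ beta)%:C + cpow (nu%:C + s) beta)].

(* A process indexed by [0, +oo[ is encoded by its paths, extended by 0 to the
   negative reals. [cumulative R R] bundles monotonicity and right continuity,
   so that each path induces a Lebesgue-Stieltjes measure dN. *)
Definition counting_process d (T : measurableType d) (R : realType)
    (N : T -> cumulative R R) : Prop :=
  [/\ forall t, measurable_fun setT (fun w => N w t),
      forall w t, t <= 0 -> N w t = 0 &
      forall w t, exists k : nat, N w t = k%:R].

Definition history d (T : measurableType d) (R : realType)
    (N : T -> cumulative R R) (t : R) : set (set T) :=
  <<s \bigcup_(s in `[0, t])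
        preimage_set_system setT (fun w => N w s) (@measurable _ R) >>.

(* q is a version of the conditional probability P(A | G). *)
Definition is_cond_prob d (T : measurableType d) (R : realType)
    (P : probability T R) (G : set (set T)) (A : set T) (q : T -> R) : Prop :=
  [/\ forall B : set R, measurable B -> G (q @^-1` B),
      P.-integrable setT (fun w => (q w)%:E) &
      forall C, G C -> (\int[P]_(w in C) (q w)%:E)%E = P (A `&` C)].

(* Lambda(t | H_t). The integral runs over [0, t[: an event at time t does not
   contribute to the intensity at t, where f would be evaluated at 0. *)
Definition intensity d (T : measurableType d) (R : realType)
    (N : T -> cumulative R R) (Lambda0 alpha : R) (f : R -> R)
    (t : R) (w : T) : R :=
  Lambda0 + alpha * \int[lebesgue_stieltjes_measure (N w)]_(u in `[0, t[)
                       f (t - u).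

(* The o(h) are almost sure, as h tends to 0 from the right, for suitable
   versions q0, q1, q2 of the conditional probabilities given H_t of the events
   that N(t + h) - N(t) is 0, is 1, is at least 2. *)
Definition hawkes_process d (T : measurableType d) (R : realType)
    (P : probability T R) (N : T -> cumulative R R)
    (Lambda0 alpha : R) (f : R -> R) : Prop :=
  counting_process N /\
  forall t, 0 <= t -> exists q0 q1 q2 : R -> T -> R,
    (forall h, 0 < h ->
      [/\ is_cond_prob P (history N t)
            [set w | N w (t + h) - N w t = 0] (q0 h),
          is_cond_prob P (history N t)
            [set w | N w (t + h) - N w t = 1] (q1 h) &
          is_cond_prob P (history N t)
            [set w | 2 <= N w (t + h) - N w t] (q2 h)]) /\
    {ae P, forall w, let L := intensity N Lambda0 alpha f t w in
      [/\ (q1 h w - L * h) / h @[h --> 0^'+] --> (0 : R),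
          (q0 h w - (1 - L * h)) / h @[h --> 0^'+] --> (0 : R) &
          q2 h w / h @[h --> 0^'+] --> (0 : R)]}.

(* Main.v *)
Require Import Defs.
From HB Require Import structures.
From mathcomp Require Import all_boot all_order all_algebra.
From mathcomp Require Import all_classical all_reals all_analysis.
From mathcomp Require Import measurable_realfun ring lra.

Set Implicit Arguments.
Unset Strict Implicit.
Unset Printing Implicit Defensive.

Import Order.TTheory GRing.Theory Num.Theory.
Import numFieldNormedType.Exports.

Local Open Scope classical_set_scope.
Local Open Scope ring_scope.
Local Open Scope complex_scope.

(** Only the values of the Laplace transform of lambda at large real p matter.
With c := (alpha - 1) gamma + nu^beta, the prescribed transform is
  Lambda0 / p * (1 + alpha gamma / ((p + nu)^beta - c)),
so the mean count, being the primitive of lambda, has this divided by p as its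
transform (has_laplace_primitive).  The right-hand side of the formula has the
same transform.  Indeed, with q := (p + nu)^beta,
  1 + alpha gamma / (q - c) = (1 - alpha gamma / c) + (alpha gamma / c) q / (q - c),
where 1 - alpha gamma / c = (nu^beta - gamma) / c; over p^2, the first summand is
the transform of the linear term.  The second one comes from the double
Mittag-Leffler series, the factor exp(- nu t) accounting for the shift from p to
P := p + nu: expanding 1/(P - nu)^2 and P^beta / (P^beta - c) into geometric
series gives the sum over (m, n, j) of (nu/P)^m (nu/P)^n (c/P^beta)^j / P^2, and
each of these terms is the transform of a multiple of
t^(beta j + m + n + 1) / Gamma(beta j + m + n + 2) (has_laplace_powR).

The exchange of the triple sum with the integral rests on one estimate,
ml_monomial_bound: since Gamma x >= A^(x-1) exp(- A - 1) for every A >= 0, the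
choice A := B t with B large bounds the (m, n, j) term at t by
exp(B t + 1) / 2^(m + n + j).  This gives at once the convergence claims, the
continuity of the sum in t and an integrable majorant of the partial sums.

The equality of transforms implies equality of the functions by Lerch's
theorem (laplace_eq0), proved by Phragmen's device: if the transform of g
vanishes for all large p, then so does that of exp(- M exp(- a t)) g(t), by
expanding the outer exponential, and these factors can be made to tend to the
indicator of ]T, +oo[. *)

(** * One-sided Laplace transform on the real axis *)

(** Integrability is part of the predicate because the Lebesgue integral of a
non-integrable function has a meaningless real value. *)
Definition has_laplace (R : realType) (g : R -> R) (p l : R) : Prop :=
  (@lebesgue_measure R).-integrable `[0, +oo[
    (fun t => (expR (- (p * t)) * g t)%:E) /\
  \int[@lebesgue_measure R]_(t in `[0, +oo[) (expR (- (p * t)) * g t) = l.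

Section laplace_transform.
Variable R : realType.
Implicit Types (f g : R -> R) (p l : R).
Notation mu := (@lebesgue_measure R).

Lemma Rdominated_convergence (D : set R) (u : nat -> R -> R) f g :
  measurable D ->
  (forall n, measurable_fun D (u n)) ->
  (forall t, D t -> u n t @[n --> \oo] --> f t) ->
  mu.-integrable D (EFin \o g) ->
  (forall n t, D t -> `|u n t| <= g t) ->
  mu.-integrable D (EFin \o f) /\
  \int[mu]_(t in D) u n t @[n --> \oo] --> \int[mu]_(t in D) f t.
Proof.
move=> mD mu_ uf ig ug.
have mf : measurable_fun D f.
  apply: (measurable_fun_cvg (h := u)) => //.
have [|||//||if_ _ cf] := @dominated_convergence _ _ _ mu D mD
    (fun n t => (u n t)%:E) (EFin \o f) (EFin \o g).
- by move=> n; apply/measurable_EFinP; exact: mu_.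
- exact/measurable_EFinP.
- by apply: aeW => /= t Dt; apply: cvg_EFin; [exact: nearW|exact: uf].
- by apply: aeW => /= t n Dt; rewrite lee_fin; exact: ug.
split => //.
apply: fine_cvg; by rewrite fineK; [exact: cf|exact: integrable_fin_num].
Qed.

Lemma measurable_laplace_integrand p g :
  measurable_fun (`[0, +oo[ : set R) g ->
  measurable_fun (`[0, +oo[ : set R) (fun t => expR (- (p * t)) * g t).
Proof.
move=> mg; apply: measurable_funM => //.
by apply: measurableT_comp => //; apply: measurableT_comp.
Qed.

Lemma has_laplace_measurable g p l :
  has_laplace g p l -> measurable_fun (`[0, +oo[ : set R) g.
Proof.
move=> [/measurable_int/measurable_EFinP mg _].
have := @measurable_laplace_integrand (- p) _ mg.
apply: eq_measurable_fun => t _.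
by rewrite mulrA -expRD mulNr opprK subrr expR0 mul1r.
Qed.

Lemma eq_has_laplace g f p l : (forall t, 0 <= t -> g t = f t) ->
  has_laplace g p l -> has_laplace f p l.
Proof.
move=> gf [ig <-]; split.
  apply: eq_integrable ig => // t; rewrite inE/= in_itv/= andbT => t0.
  by rewrite gf.
by apply: eq_Rintegral => t; rewrite inE/= in_itv/= andbT => t0; rewrite gf.
Qed.

Lemma has_laplaceZ g p l (k : R) :
  has_laplace g p l -> has_laplace (fun t => k * g t) p (k * l).
Proof.
move=> [ig <-]; split.
  have := integrableZl _ k ig; move=> /(_ (measurable_itv _)).
  apply: eq_integrable => // t _ /=; rewrite -EFinM; congr EFin; ring.
rewrite -RintegralZl//; apply: eq_Rintegral => t _; ring.
Qed.

Lemma has_laplaceD f g p l m : has_laplace f p l -> has_laplace g p m ->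
  has_laplace (fun t => f t + g t) p (l + m).
Proof.
move=> [fi <-] [gi <-]; split.
  have := integrableD _ fi gi; move=> /(_ (measurable_itv _)).
  by apply: eq_integrable => // t _ /=; rewrite -EFinD; congr EFin; ring.
rewrite -RintegralD//; apply: eq_Rintegral => t _; ring.
Qed.

Lemma has_laplace0 p : has_laplace (fun=> 0 : R) p 0.
Proof.
split; first by apply: eq_integrable (integrable0 _ _) => // t _; rewrite mulr0.
by under eq_Rintegral do rewrite mulr0; rewrite Rintegral_cst// mul0r.
Qed.

Lemma has_laplace_sum (I : Type) (s : seq I) (g : I -> R -> R) (l : I -> R) p :
  (forall i, has_laplace (g i) p (l i)) ->
  has_laplace (fun t => \sum_(i <- s) g i t) p (\sum_(i <- s) l i).
Proof.
move=> gl; elim: s => [|i s ih].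
  rewrite big_nil; apply: eq_has_laplace (has_laplace0 p) => t _.
  by rewrite big_nil.
rewrite big_cons; apply: eq_has_laplace (has_laplaceD (gl i) ih) => t _.
by rewrite big_cons.
Qed.

(** Damping by an exponential translates the transform. *)
Lemma has_laplace_shift g p nu l : has_laplace g (p + nu) l ->
  has_laplace (fun t => expR (- (nu * t)) * g t) p l.
Proof.
have E t : expR (- (p * t)) * (expR (- (nu * t)) * g t) =
    expR (- ((p + nu) * t)) * g t.
  by rewrite mulrA -expRD; congr (expR _ * _); ring.
move=> [ig <-]; split; first by apply: eq_integrable ig => // t _; rewrite E.
by apply: eq_Rintegral => t _; rewrite E.
Qed.

Lemma is_derive_expRM (c x : R) :
  is_derive x 1 (fun t => expR (c * t)) (c * expR (c * x)).
Proof.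
have dl : is_derive x 1 (fun t : R => c * t) c.
  have := @is_deriveZ _ _ _ id c x 1 1 (is_derive_id _ _).
  by rewrite /GRing.scale/= mulr1.
by rewrite mulrC; exact: (@is_derive1_comp _ expR (fun t => c * t)).
Qed.

Lemma cvg_expRN p : 0 < p -> expR (- p * t) @[t --> +oo] --> (0 : R).
Proof.
move=> p0; under eq_fun do rewrite mulNr.
apply: (@cvg_comp _ _ _ (fun t => p * t) (fun z => expR (- z)) _ +oo).
  exact: gt0_cvgMry.
exact: cvgr_expR.
Qed.

Lemma has_laplace1 p : 0 < p -> has_laplace (fun=> 1) p p^-1.
Proof.
move=> p0.
have dF (x : R) : is_derive x (1 : R) (fun t => - p^-1 * expR (- p * t)) (expR (- p * x)).
  have := is_deriveZ (- p^-1) (is_derive_expRM (- p) x).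
  by rewrite /GRing.scale/= mulrA mulrNN mulVf ?mul1r// gt_eqF.
have cF (x : R) : {for x, continuous (fun t => - p^-1 * expR (- p * t))}.
  by apply/differentiable_continuous/derivable1_diffP; case: (dF x).
have cE (x : R) : {for x, continuous (fun t : R => expR (- p * t))}.
  apply/differentiable_continuous/derivable1_diffP.
  by case: (is_derive_expRM (- p) x).
have I : (\int[mu]_(t in `[0%R, +oo[) (expR (- p * t))%:E = (p^-1)%:E)%E.
  rewrite (@ge0_continuous_FTC2y _ _ (fun t => - p^-1 * expR (- p * t)) _ 0)//.
  - by rewrite mulr0 expR0 mulr1 EFinN oppeK add0e.
  - exact: continuous_subspaceT.
  - by rewrite -(mulr0 (- p^-1)); apply: cvgMr; exact: cvg_expRN.
  - by apply/cvg_at_right_filter; exact: cF.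
  - by move=> x _; rewrite derive1E; exact: derive_val.
have E : (fun t : R => (expR (- (p * t)) * 1)%:E) =
    (fun t : R => (expR (- p * t))%:E).
  by apply/funext => t; rewrite mulr1 mulNr.
split; last by rewrite /Rintegral E I.
rewrite E; apply/integrableP; split.
  by apply/measurable_EFinP; apply: measurableT_comp => //; exact: measurable_funM.
under eq_integral do rewrite /= ger0_norm ?expR_ge0//.
by rewrite I ltry.
Qed.

End laplace_transform.

(** * Bounds and Laplace transforms involving the Gamma function *)

Section gamma_function.
Variable R : realType.
Implicit Types (x y p A : R).
Notation mu := (@lebesgue_measure R).

Lemma powR_continuous_ge0 y : 0 < y ->
  {within `[0, +oo[, continuous (fun t : R => t `^ y)}.
Proof.
move=> y0; apply/continuous_within_itvcyP; split.
  move=> x; rewrite in_itv/= andbT => x0.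
  apply/differentiable_continuous/derivable1_diffP.
  by case: (is_derive1_powR y x0).
by rewrite powR0 ?gt_eqF//; exact: powR_cvg0.
Qed.

(** Raise p t / y <= exp(p t / y) to the power y. *)
Lemma powR_le_expR y p : 0 < y -> 0 < p ->
  exists2 C : R, 0 <= C & forall t : R, 0 <= t -> t `^ y <= C * expR (p * t).
Proof.
move=> y0 p0; exists ((y / p) `^ y) => [|t t0]; first exact: powR_ge0.
have le1 : t <= y / p * expR (p * t / y).
  have : p * t / y <= expR (p * t / y).
    by apply: le_trans (expR_ge1Dx _); rewrite lerDr.
  move=> /(ler_wpM2l (ltW (divr_gt0 y0 p0))); apply: le_trans.
  by rewrite le_eqVlt; apply/orP; left; apply/eqP; field; rewrite !gt_eqF.
have := @ge0_ler_powR _ y (ltW y0) t _ _ _ le1.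
rewrite !nnegrE; move=> /(_ t0).
have yp0 : 0 <= y / p by rewrite divr_ge0// ltW.
rewrite mulr_ge0 ?expR_ge0// => /(_ isT) /le_trans; apply.
by rewrite powRM ?expR_ge0// -expRM divfK// gt_eqF.
Qed.

Lemma integrable_powR_expR y p : 0 < y -> 0 < p ->
  mu.-integrable `[0, +oo[ (fun t => (expR (- (p * t)) * t `^ y)%:E).
Proof.
move=> y0 p0; have p20 : 0 < p / 2 by rewrite divr_gt0.
have [C C0 tC] := powR_le_expR y0 p20.
have [i1 _] := has_laplaceZ C (has_laplace1 p20).
apply: le_integrable i1 => //.
  apply/measurable_EFinP; apply: measurable_laplace_integrand.
  by apply: measurable_funTS; exact: measurable_powR.
move=> t; rewrite /= in_itv/= andbT => t0.
rewrite lee_fin !ger0_norm ?mulr_ge0 ?expR_ge0 ?powR_ge0//.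
rewrite mulr1 [leRHS]mulrC; apply: le_trans (ler_wpM2l (expR_ge0 _) (tC t t0)) _.
rewrite mulrCA -expRD le_eqVlt; apply/orP; left; apply/eqP.
by congr (_ * expR _); field.
Qed.

(** The integrand also makes sense at 0, and the point does not contribute. *)
Lemma GammaE x : 1 < x ->
  Gamma x = \int[mu]_(u in `[0, +oo[) (u `^ (x - 1) * expR (- u)).
Proof.
move=> x1; rewrite /Gamma Rintegral_itv_obnd_cbnd//.
have x10 : 0 < x - 1 by rewrite subr_gt0.
have : mu.-integrable `[0, +oo[ (fun u => (u `^ (x - 1) * expR (- u))%:E).
  apply: eq_integrable (integrable_powR_expR x10 ltr01) => // t _.
  by rewrite mul1r mulrC.
apply: integrableS => //.
by apply: subset_itvr; rewrite bnd_simp.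
Qed.

(** Substitute u := p t in the integral that defines Gamma. *)
Lemma has_laplace_powR x p : 1 < x -> 0 < p ->
  has_laplace (fun t => t `^ (x - 1)) p (Gamma x * p `^ (- x)).
Proof.
move=> x1 p0; have x10 : 0 < x - 1 by rewrite subr_gt0.
have ip := integrable_powR_expR x10 p0.
split => //; rewrite GammaE// -RintegralZr//; last first.
  apply: eq_integrable (integrable_powR_expR x10 ltr01) => // t _.
  by rewrite mul1r mulrC.
pose F t : R := p * t; pose G u : R := u `^ (x - 1) * expR (- u) * p `^ (- x).
have dF t : is_derive t (1 : R) F p.
  have := @is_deriveZ _ _ _ id p t 1 1 (is_derive_id _ _).
  by rewrite /GRing.scale/= mulr1.
have F' : F^`()%classic = cst p.
  by apply/funext => t; rewrite derive1E; exact: derive_val.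
have F0 : F 0 = 0 by rewrite /F mulr0.
congr fine; rewrite -/(G _).
rewrite -{2}F0 (@increasing_ge0_integration_by_substitutiony _ F G 0).
- apply: eq_integral => t; rewrite inE/= in_itv/= andbT => t0.
  rewrite F' /G /F !fctE; congr EFin; rewrite /= powRM ?(ltW p0)//.
  have -> : p `^ (x - 1) = p `^ x / p.
    by rewrite powRB ?gt_eqF ?implybT// powRr1// ltW.
  rewrite powRN.
  by field; rewrite !gt_eqF// powR_gt0.
- by move=> a b _ _ ab; rewrite /F ltr_pM2l.
- by rewrite F' => t _; exact: cst_continuous.
- by rewrite F'; exact: is_cvg_cst.
- by rewrite F'; exact: is_cvg_cst.
- split; first by move=> t _; case: (dF t).
  apply/cvg_at_right_filter/differentiable_continuous/derivable1_diffP.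
  by case: (dF 0).
- exact: gt0_cvgMry.
- rewrite F0; move=> z; apply: cvgM; last exact: cvg_cst.
  apply: cvgM; first exact: powR_continuous_ge0.
  apply: continuous_subspaceT => t; apply: continuous_comp.
    exact: opp_continuous.
  exact: continuous_expR.
- by move=> t _; rewrite /G !mulr_ge0// ?powR_ge0 ?expR_ge0.
Qed.

(** Keep only the part of the integral over [A, A + 1], where the integrand is at
least A^(x-1) exp(- A - 1).  The freedom in A makes 1 / Gamma decay faster than
any geometric sequence. *)
Lemma Gamma_ge x A : 1 < x -> 0 <= A -> A `^ (x - 1) * expR (- (A + 1)) <= Gamma x.
Proof.
move=> x1 A0; have x10 : 0 < x - 1 by rewrite subr_gt0.
pose G u : R := u `^ (x - 1) * expR (- u).
have iG : mu.-integrable `[0, +oo[ (EFin \o G).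
  apply: eq_integrable (integrable_powR_expR x10 ltr01) => // t _.
  by rewrite mul1r mulrC.
have sub : `[A, A + 1] `<=` `[0%R, +oo[.
  move=> t /=; rewrite !in_itv/= andbT => /andP[+ _]; exact: le_trans.
have iGA : mu.-integrable `[A, A + 1] (EFin \o G) by exact: integrableS iG.
have mA : fine (mu `[A, A + 1]) = 1.
  by rewrite lebesgue_measure_itv/= lte_fin ltrDl ltr01/= addrAC subrr add0r.
rewrite GammaE// -[leLHS]mulr1 -[X in _ * X]mA -Rintegral_cst//.
apply: (@le_trans _ _ (\int[mu]_(u in `[A, A + 1]) G u)).
  apply: le_Rintegral => //.
    apply: continuous_compact_integrable; first exact: segment_compact.
    by apply: continuous_subspaceT => t; exact: cst_continuous.
  move=> t /=; rewrite in_itv/= => /andP[At tA]; rewrite /G.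
  apply: ler_pM; rewrite ?powR_ge0 ?expR_ge0//.
    apply: (ge0_ler_powR (ltW x10)); rewrite ?nnegrE//.
    exact: le_trans At.
  by rewrite ler_expR lerN2.
apply: fine_le.
- exact: integrable_fin_num.
- exact: integrable_fin_num.
- apply: ge0_subset_integral => //; first exact: measurable_int iG.
  by move=> t _; rewrite lee_fin mulr_ge0 ?powR_ge0 ?expR_ge0.
Qed.

Lemma Gamma_gt0 x : 1 < x -> 0 < Gamma x.
Proof.
move=> x1; apply: lt_le_trans (Gamma_ge x1 ler01).
by rewrite powR1 mul1r expR_gt0.
Qed.

End gamma_function.

(** * Iterated series dominated by a geometric one *)

Section iterated_series.
Variable R : realType.
Implicit Types (M : R) (K : nat).
Notation h := (2^-1 : R).

Lemma sum_half (m n : nat) : (m <= n)%N ->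
  \sum_(m <= k < n) h ^+ k = 2 * (h ^+ m - h ^+ n).
Proof.
elim: n => [|n ih]; first by rewrite leqn0 => /eqP ->; rewrite big_geq// subrr mulr0.
rewrite leq_eqVlt => /predU1P[->|]; first by rewrite big_geq// subrr mulr0.
rewrite ltnS => mn; rewrite big_nat_recr//= ih// exprS; by field.
Qed.

Lemma sum_half_le2 K : \sum_(0 <= k < K) h ^+ k <= 2.
Proof.
by rewrite sum_half// expr0 -[leRHS]mulr1 ler_pM2l// gerBl.
Qed.

Lemma series_half (a : nat -> R) M : (forall k, `|a k| <= M * h ^+ k) ->
  cvgn (series a) /\
  forall K, `|limn (series a) - series a K| <= 2 * M * h ^+ K.
Proof.
move=> aM.
have M0 : 0 <= M by have := aM 0%N; rewrite expr0 mulr1; exact: le_trans.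
have ca : cvgn (series a).
  apply: normed_cvg; apply: (@series_le_cvg _ _ (fun k => M * h ^+ k)).
  - by move=> n; exact: normr_ge0.
  - by move=> n; rewrite mulr_ge0// exprn_ge0// invr_ge0.
  - exact: aM.
  apply: is_cvg_geometric_series.
  by rewrite ger0_norm ?invr_ge0// invf_lt1// ltr1n.
split => // K.
have c1 : `|series a n - series a K| @[n --> \oo] --> `|limn (series a) - series a K|.
  apply: cvg_norm; apply: cvgB; [exact: ca|exact: cvg_cst].
rewrite -(cvg_lim _ c1)//; apply: limr_le; first by apply/cvg_ex; eexists; exact: c1.
near=> n; have Kn : (K <= n)%N by near: n; exists K.
rewrite sub_series_geq//; apply: le_trans (ler_norm_sum _ _ _) _.
apply: le_trans (ler_sum _ (fun k _ => aM k)) _.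
rewrite -mulr_sumr sum_half// mulrA (mulrC M) ler_wpM2l ?mulr_ge0// gerBl.
by rewrite exprn_ge0// invr_ge0.
Unshelve. all: by end_near. Qed.

(** Replacing the three limits one at a time, outermost first, by partial sums
of length K costs at most 8 M / 2^K each time. *)
Lemma triple_series (V : nat -> nat -> nat -> R) M :
  (forall m n j, `|V m n j| <= M * h ^+ m * h ^+ n * h ^+ j) ->
  let A m n := limn (series (V m n)) in
  let A1 m := limn (series (A m)) in
  let S := limn (series A1) in
  [/\ forall m n, cvgn (series (V m n)), forall m, cvgn (series (A m)),
      cvgn (series A1), `|S| <= 8 * M &
      forall K, `|S - \sum_(0 <= m < K) \sum_(0 <= n < K) \sum_(0 <= j < K) V m n j|
        <= 24 * M * h ^+ K].
Proof.
move=> VM A A1 S.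
have hK0 K : 0 <= h ^+ K by rewrite exprn_ge0// invr_ge0.
have M0 : 0 <= M by have := VM 0%N 0%N 0%N; rewrite !expr0 !mulr1; exact: le_trans.
have sV m n := series_half (VM m n).
have AM m n : `|A m n| <= 2 * M * h ^+ m * h ^+ n.
  have [_ /(_ 0%N)] := sV m n.
  by rewrite /series/= big_geq// subr0 expr0 mulr1 !mulrA.
have sA m := series_half (AM m).
have A1M m : `|A1 m| <= 4 * M * h ^+ m.
  have [_ /(_ 0%N)] := sA m.
  by rewrite /series/= big_geq// subr0 expr0 mulr1 !mulrA -natrM.
have sA1 := series_half A1M.
split.
- by move=> m n; case: (sV m n).
- by move=> m; case: (sA m).
- by case: sA1.
- case: sA1 => _ /(_ 0%N).
  by rewrite /series/= big_geq// subr0 expr0 mulr1 !mulrA -natrM.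
move=> K; set F := \sum_(0 <= m < K) _.
have sum_le (C : R) : 0 <= C -> \sum_(0 <= k < K) C * h ^+ k <= 2 * C.
  by move=> C0; rewrite -mulr_sumr mulrC ler_wpM2r// sum_half_le2.
pose F2 : R := \sum_(0 <= m < K) \sum_(0 <= n < K) A m n.
have -> : S - F = (S - series A1 K) + (series A1 K - F2) + (F2 - F) by ring.
have -> : 24 * M * h ^+ K = 8 * M * h ^+ K + 8 * M * h ^+ K + 8 * M * h ^+ K by ring.
apply: le_trans (ler_normD _ _) _; apply: lerD.
  apply: le_trans (ler_normD _ _) _; apply: lerD.
    case: sA1 => _ /(_ K); rewrite !mulrA -natrM; exact.
  rewrite /F2 /series/= -sumrB; apply: le_trans (ler_norm_sum _ _ _) _.
  apply: (@le_trans _ _ (\sum_(0 <= m < K) (4 * M * h ^+ K) * h ^+ m)).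
    apply: ler_sum => m _; case: (sA m) => _ /(_ K) /le_trans; apply.
    by rewrite le_eqVlt; apply/orP; left; apply/eqP; ring.
  by apply: le_trans (sum_le _ _) _; rewrite ?mulr_ge0// !mulrA -natrM.
rewrite /F2 /F -sumrB; apply: le_trans (ler_norm_sum _ _ _) _.
apply: (@le_trans _ _ (\sum_(0 <= m < K) (4 * M * h ^+ K) * h ^+ m)).
  apply: ler_sum => m _; rewrite -sumrB; apply: le_trans (ler_norm_sum _ _ _) _.
  apply: (@le_trans _ _ (\sum_(0 <= n < K) (2 * M * h ^+ K * h ^+ m) * h ^+ n)).
    apply: ler_sum => n _; case: (sV m n) => _ /(_ K) /le_trans; apply.
    by rewrite le_eqVlt; apply/orP; left; apply/eqP; ring.
  by apply: le_trans (sum_le _ _) _; rewrite ?mulr_ge0// !mulrA -natrM.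
by apply: le_trans (sum_le _ _) _; rewrite ?mulr_ge0// !mulrA -natrM.
Qed.

End iterated_series.

(** * Terms of the Mittag-Leffler double series *)

Section mittag_leffler_terms.
Variables (R : realType) (beta nu c : R).
Hypotheses (beta0 : 0 < beta) (nu0 : 0 <= nu).
Implicit Types (m n j : nat) (t p B : R).
Notation h := (2^-1 : R).

(** The (m, n, j) term of the double series once each Mittag-Leffler function is
expanded; it is a constant times the power beta j + m + n + 1 of t. *)
Definition ml_monomial m n j t : R := nu ^+ (n + m) * t ^+ (m + n + 1) *
  mittag_leffler_term 1 beta (m + n + 2)%:R (c * t `^ beta) j.

Lemma mittag_leffler_term1E (b z : R) j :
  mittag_leffler_term 1 beta b z j = z ^+ j / Gamma (beta * j%:R + b).
Proof.
rewrite /mittag_leffler_term /pochhammer.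
have -> : \prod_(i < j) (1 + i%:R) = j`!%:R :> R.
  rewrite fact_prod natr_prod big_add1 big_mkord.
  by apply: eq_bigr => i _; rewrite nat1r.
have f0 : j`!%:R != 0 :> R by rewrite pnatr_eq0 -lt0n fact_gt0.
by rewrite mulrCA mulrA -mulrA [X in _ = _ / X]/= mulrAC divff// mul1r.
Qed.

Let expo m n j : beta * j%:R + (m + n + 2)%:R - 1 = beta * j%:R + (m + n + 1)%:R.
Proof. by rewrite !natrD; ring. Qed.

Let expo_gt1 m n j : 1 < beta * j%:R + (m + n + 2)%:R.
Proof.
rewrite -[ltLHS]add0r ler_ltD// ?mulr_ge0 ?ler0n ?(ltW beta0)//.
by rewrite ltr1n addn2.
Qed.

Let powR_expo m n j t : 0 <= t ->
  t `^ (beta * j%:R + (m + n + 1)%:R) = (t `^ beta) ^+ j * t ^+ (m + n + 1).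
Proof.
move=> t0; rewrite powRD; last first.
  by rewrite gt_eqF ?implyFb// ltr_wpDl ?ltr0n ?addn1// mulr_ge0// ltW.
by rewrite powRrM !powR_mulrn// powR_ge0.
Qed.

Lemma ml_monomialE m n j t : 0 <= t -> ml_monomial m n j t =
  nu ^+ (n + m) * c ^+ j / Gamma (beta * j%:R + (m + n + 2)%:R) *
  t `^ (beta * j%:R + (m + n + 2)%:R - 1).
Proof.
move=> t0; rewrite /ml_monomial mittag_leffler_term1E expo powR_expo// exprMn.
by rewrite -!mulrA; ring.
Qed.

(** Gamma_ge with A := B t: the powers of t cancel exactly, leaving powers of
nu / B and c / B^beta, which are at most 1/2. *)
Lemma ml_monomial_bound B m n j t : 1 <= B -> 2 * nu <= B -> 2 * `|c| <= B `^ beta ->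
  0 <= t -> `|ml_monomial m n j t| <= expR (B * t + 1) * h ^+ m * h ^+ n * h ^+ j.
Proof.
move=> B1 Bnu Bc t0; have B0 : 0 < B by exact: lt_le_trans B1.
rewrite ml_monomialE//; set x := beta * j%:R + (m + n + 2)%:R.
have G0 : 0 < Gamma x by apply: Gamma_gt0; exact: expo_gt1.
have Bb0 : 0 < B `^ beta by exact: powR_gt0.
have Bx : B `^ (x - 1) = B `^ beta ^+ j * B ^+ (m + n + 1).
  by rewrite /x expo powR_expo// ltW.
have := Gamma_ge (expo_gt1 m n j) (mulr_ge0 (ltW B0) t0).
rewrite -/x powRM ?(ltW B0)// Bx => GE.
rewrite !normrM normfV (gtr0_norm G0) !normrX (ger0_norm nu0) (ger0_norm (powR_ge0 _ _)).
have {GE} GE : t `^ (x - 1) / Gamma x <= expR (B * t + 1) / (B `^ beta ^+ j * B ^+ (m + n + 1)).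
  rewrite ler_pdivlMr; last by rewrite mulr_gt0// exprn_gt0.
  rewrite mulrAC ler_pdivrMr// -ler_pdivrMl ?expR_gt0// -expRN.
  by apply: le_trans GE; rewrite le_eqVlt; apply/orP; left; apply/eqP; ring.
have -> : nu ^+ (n + m) * `|c| ^+ j / Gamma x * t `^ (x - 1) =
   nu ^+ (n + m) * `|c| ^+ j * (t `^ (x - 1) / Gamma x) by ring.
apply: le_trans (ler_wpM2l _ GE) _; first by rewrite mulr_ge0// exprn_ge0.
have -> : nu ^+ (n + m) * `|c| ^+ j * (expR (B * t + 1) / (B `^ beta ^+ j * B ^+ (m + n + 1)))
   = expR (B * t + 1) * ((nu / B) ^+ m * (nu / B) ^+ n * (`|c| / B `^ beta) ^+ j * B^-1).
  rewrite !exprMn !exprVn !exprD expr1; field.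
  by rewrite !expf_neq0// gt_eqF.
rewrite -!mulrA ler_wpM2l ?expR_ge0// !mulrA -[leRHS]mulr1.
have q1 : nu / B <= h by rewrite ler_pdivrMr// ler_pdivlMl.
have q2 : `|c| / B `^ beta <= h by rewrite ler_pdivrMr// ler_pdivlMl.
have q10 : 0 <= nu / B by rewrite divr_ge0// ltW.
have q20 : 0 <= `|c| / B `^ beta by rewrite divr_ge0// ltW.
rewrite !ler_pM ?mulr_ge0 ?exprn_ge0 ?invr_ge0 ?lerXn2r ?nnegrE ?invr_ge0 ?(ltW B0)//.
by rewrite invf_le1.
Qed.

Lemma has_laplace_ml_monomial m n j p : 0 < p ->
  has_laplace (ml_monomial m n j) p
    (p^-2 * (nu / p) ^+ m * (nu / p) ^+ n * (c / p `^ beta) ^+ j).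
Proof.
move=> p0; have := has_laplaceZ
  (nu ^+ (n + m) * c ^+ j / Gamma (beta * j%:R + (m + n + 2)%:R))
  (has_laplace_powR (expo_gt1 m n j) p0).
have -> : p^-2 * (nu / p) ^+ m * (nu / p) ^+ n * (c / p `^ beta) ^+ j =
   nu ^+ (n + m) * c ^+ j / Gamma (beta * j%:R + (m + n + 2)%:R) *
  (Gamma (beta * j%:R + (m + n + 2)%:R) * p `^ (- (beta * j%:R + (m + n + 2)%:R))).
  have pb0 : 0 < p `^ beta by exact: powR_gt0.
  have -> : (m + n + 2)%:R = (m + n.+1 + 1)%:R :> R by rewrite !addnS.
  rewrite powRN powR_expo ?(ltW p0)// addn1 addnS.
  rewrite !exprMn !exprVn !exprS !exprD; field.
  rewrite !expf_neq0 ?gt_eqF//= Gamma_gt0//.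
  by have := expo_gt1 m n j; rewrite !addnS addn0.
apply: eq_has_laplace => t t0.
by rewrite ml_monomialE.
Qed.

End mittag_leffler_terms.

(** * Passage to the limit in Laplace transforms *)

Section limits.
Variable R : realType.
Implicit Types (f g : R -> R) (p l : R).
Notation mu := (@lebesgue_measure R).

Lemma has_laplace_lim (u : nat -> R -> R) (v : nat -> R) f g p l m :
  (forall n, has_laplace (u n) p (v n)) ->
  (forall t, 0 <= t -> u n t @[n --> \oo] --> f t) ->
  has_laplace g p m -> (forall n t, 0 <= t -> `|u n t| <= g t) ->
  v n @[n --> \oo] --> l -> has_laplace f p l.
Proof.
move=> uv uf [ig _] ug vl.
have [||||if_ cf] := @Rdominated_convergence _ (`[0%R, +oo[)
  (fun n t => expR (- (p * t)) * u n t) (fun t => expR (- (p * t)) * f t)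
  (fun t => expR (- (p * t)) * g t) (measurable_itv _).
- by move=> n; apply: measurable_laplace_integrand; exact: has_laplace_measurable (uv n).
- move=> t; rewrite /= in_itv/= andbT => t0.
  by apply: cvgMr; exact: uf.
- exact: ig.
- move=> n t; rewrite /= in_itv/= andbT => t0.
  by rewrite normrM ger0_norm ?expR_ge0// ler_wpM2l ?expR_ge0// ug.
split => //; rewrite -(cvg_lim _ cf)//; apply: cvg_lim => //.
by apply: cvg_trans vl; apply: near_eq_cvg; apply: nearW => n; case: (uv n).
Qed.

Lemma has_laplace_expR (C B p : R) : B < p ->
  has_laplace (fun t => C * expR (B * t)) p (C / (p - B)).
Proof.
move=> Bp; have pB : 0 < p + - B by rewrite subr_gt0.
have := has_laplaceZ C (has_laplace_shift (has_laplace1 pB)).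
by apply: eq_has_laplace => t _; rewrite mulr1 mulNr opprK.
Qed.

Lemma continuous_sum (I : Type) (s : seq I) (g : I -> R -> R) (t : R) :
  (forall i, {for t, continuous (g i)}) ->
  {for t, continuous (fun x => \sum_(i <- s) g i x)}.
Proof.
move=> cg; elim: s => [|i s ih].
  rewrite /prop_for /continuous_at big_nil.
  by under eq_fun do rewrite big_nil; exact: cvg_cst.
rewrite /prop_for /continuous_at big_cons.
by under eq_fun do rewrite big_cons; apply: cvgD; [exact: cg|exact: ih].
Qed.

End limits.

(** * Sum of the Mittag-Leffler double series *)

Section mittag_leffler_sum.
Variables (R : realType) (beta nu c : R).
Hypotheses (beta0 : 0 < beta) (nu0 : 0 <= nu).
Implicit Types (m n j K : nat) (t p B : R).
Notation h := (2^-1 : R).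

(** B is the exponential type with which all the series below are dominated. *)
Lemma exponential_type_exists (w z : R) : 0 <= w ->
  exists B : R, [/\ 1 <= B, 2 * w <= B & 2 * `|z| <= B `^ beta].
Proof.
move=> w0; pose y := (2 * `|z|) `^ beta^-1.
have y0 : 0 <= y by exact: powR_ge0.
have w20 : 0 <= 2 * w by rewrite mulr_ge0.
exists (1 + 2 * w + y); split.
- by rewrite -addrA lerDl addr_ge0.
- by rewrite addrAC lerDr addr_ge0.
have -> : 2 * `|z| = y `^ beta.
  by rewrite /y -powRrM mulVf ?gt_eqF// powRr1// mulr_ge0.
apply: (ge0_ler_powR (ltW beta0)); rewrite ?nnegrE// ?addr_ge0//.
by rewrite lerDr addr_ge0.
Qed.

(** Instance of the triple series with nu := 1, t := 1 and c := z, for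
which the coefficient in front of the Mittag-Leffler function is 1. *)
Lemma is_cvg_mittag_leffler m n (z : R) :
  cvgn (series (mittag_leffler_term 1 beta (m + n + 2)%:R z)).
Proof.
have [B [B1 Bnu Bz]] := exponential_type_exists z ler01.
have H := fun m n j => ml_monomial_bound beta0 ler01 m n j B1 Bnu Bz ler01.
have [/(_ m n) + _ _ _ _] := triple_series H.
rewrite /ml_monomial; under eq_fun do rewrite !expr1n !mul1r powR1 mulr1.
exact.
Qed.

Definition ml_sum t : R := limn (series (fun m => limn (series (fun n =>
  nu ^+ (n + m) * t ^+ (m + n + 1) *
  mittag_leffler 1 beta (m + n + 2)%:R (c * t `^ beta))))).

(** Cubic partial sums, whose transforms factor into three geometric sums. *)
Definition ml_box K t : R := \sum_(0 <= m < K) \sum_(0 <= n < K)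
  \sum_(0 <= j < K) ml_monomial beta nu c m n j t.

Lemma ml_sum_box B t : 1 <= B -> 2 * nu <= B -> 2 * `|c| <= B `^ beta -> 0 <= t ->
  let a m n := nu ^+ (n + m) * t ^+ (m + n + 1) *
    mittag_leffler 1 beta (m + n + 2)%:R (c * t `^ beta) in
  [/\ forall m, cvgn (series (a m)),
      cvgn (series (fun m => limn (series (a m)))),
      `|ml_sum t| <= 8 * expR (B * t + 1) &
      forall K, `|ml_sum t - ml_box K t| <= 24 * expR (B * t + 1) * h ^+ K].
Proof.
move=> B1 Bnu Bc t0 a.
have H := fun m n j => ml_monomial_bound beta0 nu0 m n j B1 Bnu Bc t0.
have aE : a = fun m n => limn (series (fun j => ml_monomial beta nu c m n j t)).
  apply/funext => m; apply/funext => n; rewrite /a /mittag_leffler.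
  have := lim_seriesZ (nu ^+ (n + m) * t ^+ (m + n + 1))
    (@is_cvg_mittag_leffler m n (c * t `^ beta)).
  by move=> /esym E; exact: E.
have := triple_series H; rewrite -[fun m n => limn _]aE => -[_].
by [].
Qed.

Lemma ml_box_cvg t : 0 <= t -> ml_box K t @[K --> \oo] --> ml_sum t.
Proof.
move=> t0; have [B [B1 Bnu Bc]] := exponential_type_exists c nu0.
have [_ _ _ SK] := ml_sum_box B1 Bnu Bc t0.
apply/subr_cvg0.
apply: (@norm_cvg0 R R^o).
have : 24 * expR (B * t + 1) * h ^+ K @[K --> \oo] --> (0 : R).
  apply: cvg_geometric.
  by rewrite ger0_norm ?invr_ge0// invf_lt1// ltr1n.
apply: squeeze_cvgr; last exact: cvg_cst.
by apply: nearW => K; rewrite normr_ge0 distrC SK.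
Qed.

Lemma ml_sum0 : ml_sum 0 = 0.
Proof.
have <- := cvg_lim (@Rhausdorff R) (ml_box_cvg (lexx 0)).
rewrite (_ : ml_box ^~ 0 = cst 0) ?lim_cst//.
apply/funext => K; rewrite /ml_box big1// => m _; rewrite big1// => n _.
by rewrite big1// => j _; rewrite /ml_monomial addn1 expr0n mulr0 mul0r.
Qed.

(** The transform of ml_box K is the product of three geometric partial sums over
p^2; the boxes are dominated by a multiple of exp(B t). *)
Lemma has_laplace_ml_sum B p : 1 <= B -> 2 * nu <= B -> 2 * `|c| <= B `^ beta ->
  B < p -> has_laplace ml_sum p (p `^ beta / ((p - nu) ^+ 2 * (p `^ beta - c))).
Proof.
move=> B1 Bnu Bc Bp.
have B0 : 0 < B by exact: lt_le_trans B1.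
have p0 : 0 < p by exact: lt_trans Bp.
have pb0 : 0 < p `^ beta by exact: powR_gt0.
pose q := nu / p; pose r := c / p `^ beta.
have q1 : `|q| < 1.
  by rewrite ger0_norm ?divr_ge0// ?(ltW p0)// ltr_pdivrMr// mul1r; lra.
have r1 : `|r| < 1.
  rewrite normrM normfV (gtr0_norm pb0) ltr_pdivrMr// mul1r.
  have Bb0 : 0 < B `^ beta by exact: powR_gt0.
  have := @ge0_ler_powR _ _ (ltW beta0) B p; rewrite !nnegrE.
  by move=> /(_ (ltW B0) (ltW p0) (ltW Bp)); lra.
pose s (x : R) K := \sum_(0 <= k < K) x ^+ k.
have sE x : `|x| < 1 -> s x K @[K --> \oo] --> (1 - x)^-1.
  move=> x1; have := @cvg_geometric_series _ 1 x x1; rewrite mul1r.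
  apply: cvg_trans; apply: near_eq_cvg; apply: nearW => K.
  by apply: eq_bigr => k _; rewrite /= mul1r.
apply: (@has_laplace_lim _ ml_box (fun K => p^-2 * s q K * s q K * s r K) _
  (fun t => 32 * expR 1 * expR (B * t))).
- move=> K.
  have := has_laplace_sum (index_iota 0 K) (fun m =>
    has_laplace_sum (index_iota 0 K) (fun n =>
    has_laplace_sum (index_iota 0 K) (fun j =>
      has_laplace_ml_monomial nu c beta0 m n j p0))).
  rewrite /ml_box; congr (has_laplace _ _ _).
  under eq_bigr do under eq_bigr do rewrite -mulr_sumr.
  under eq_bigr do rewrite -mulr_suml -mulr_sumr.
  by rewrite -!mulr_suml -mulr_sumr.
- exact: ml_box_cvg.
- exact: has_laplace_expR Bp.
- move=> K t t0; have [_ _ S8 SK] := ml_sum_box B1 Bnu Bc t0.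
  have h1 : h ^+ K <= 1 by rewrite exprn_ile1// ?invr_ge0// invf_le1// ler1n.
  (* 8 from the bound on the sum and 24 from the error of the box *)
  have -> : ml_box K t = ml_sum t - (ml_sum t - ml_box K t) by ring.
  apply: le_trans (ler_normB _ _) _.
  apply: le_trans (lerD S8 (SK K)) _.
  have E0 : 0 <= expR (B * t + 1) by exact: expR_ge0.
  have -> : 32 * expR 1 * expR (B * t) = 32 * expR (B * t + 1) by rewrite expRD; ring.
  suff : 24 * expR (B * t + 1) * h ^+ K <= 24 * expR (B * t + 1) by lra.
  by rewrite -[leRHS]mulr1 ler_wpM2l// mulr_ge0.
have -> : p `^ beta / ((p - nu) ^+ 2 * (p `^ beta - c)) =
    p^-2 * (1 - q)^-1 * (1 - q)^-1 * (1 - r)^-1.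
  have pn : p - nu != 0 by rewrite gt_eqF// subr_gt0; lra.
  have pc : p `^ beta - c != 0.
    rewrite subr_eq0; apply: contraTneq r1 => E.
    by rewrite /r -E divff ?gt_eqF// normr1 ltxx.
  rewrite /q /r; field.
  by rewrite pn pc !gt_eqF.
apply: cvgM; last exact: sE.
apply: cvgM; last exact: sE.
apply: cvgM; last exact: sE.
exact: cvg_cst.
Qed.

Lemma ml_monomial_continuous m n j t : 0 < t ->
  {for t, continuous (ml_monomial beta nu c m n j)}.
Proof.
move=> t0; rewrite /ml_monomial /prop_for /continuous_at mittag_leffler_term1E.
under eq_fun do rewrite mittag_leffler_term1E.
have cb : {for t, continuous (fun t : R => t `^ beta)}.
  apply/differentiable_continuous/derivable1_diffP.
  by case: (is_derive1_powR beta t0).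
apply: cvgM.
  by apply: cvgMr; exact: exprn_continuous.
apply: cvgMl.
apply: (@continuous_comp _ _ _ (fun t : R => c * t `^ beta) (fun x => x ^+ j)).
  by apply: cvgMr; exact: cb.
exact: exprn_continuous.
Qed.

(** The boxes converge uniformly on bounded intervals. *)
Lemma ml_sum_continuous t : 0 < t -> {for t, continuous ml_sum}.
Proof.
move=> t0; have [B [B1 Bnu Bc]] := exponential_type_exists c nu0.
have B0 : 0 < B by exact: lt_le_trans B1.
apply/cvgrPdist_lt => e e0.
have e3 : 0 < e / 3 by rewrite divr_gt0.
pose M := 24 * expR (B * (t + 1) + 1).
have cM : M * h ^+ K @[K --> \oo] --> (0 : R).
  apply: cvg_geometric.
  by rewrite ger0_norm ?invr_ge0// invf_lt1// ltr1n.
have /cvgrPdist_lt/(_ _ e3)[K _ /(_ K (leqnn K))] := cM.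
rewrite /= sub0r normrN => MK {cM}.
have SK s : 0 <= s -> s <= t + 1 -> `|ml_sum s - ml_box K s| < e / 3.
  move=> s0 st; have [_ _ _ /(_ K) /le_lt_trans] := ml_sum_box B1 Bnu Bc s0; apply.
  apply: le_lt_trans MK; apply: le_trans (ler_norm _).
  rewrite ler_wpM2r ?exprn_ge0 ?invr_ge0// ler_wpM2l// ler_expR lerD2r.
  by rewrite ler_wpM2l// ltW.
have cK : {for t, continuous (ml_box K)}.
  rewrite /ml_box; do 3![apply: continuous_sum => ?].
  exact: ml_monomial_continuous.
near=> s.
have split4 (x y z w : R) : x - y = (x - z) + (z - w) - (y - w) by ring.
rewrite (split4 _ _ (ml_box K t) (ml_box K s)) {split4}.
have -> : e = e / 3 + e / 3 + e / 3 by field.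
apply: le_lt_trans (ler_normB _ _) _; apply: ltrD; last first.
  apply: SK; apply/ltW; near: s; first exact: lt_nbhsr.
  by apply: lt_nbhsl; rewrite ltrDl.
apply: le_lt_trans (ler_normD _ _) _; apply: ltrD.
  by apply: SK; rewrite ?(ltW t0)// lerDl.
by near: s; move/cvgrPdist_lt : cK; exact.
Unshelve. all: by end_near. Qed.

End mittag_leffler_sum.

(** * Laplace transform of a primitive *)

Section primitive.
Variable R : realType.
Implicit Types (f g : R -> R) (p l t : R).
Notation mu := (@lebesgue_measure R).

Lemma Rintegral_cvgy f : mu.-integrable `[0, +oo[ (EFin \o f) ->
  \int[mu]_(t in `[0, n%:R]) f t @[n --> \oo] --> \int[mu]_(t in `[0, +oo[) f t.
Proof.
move=> fi; pose u (n : nat) := f \_ (`[0%R, n%:R] : set R).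
have uE n : \int[mu]_(t in `[0, n%:R]) f t = \int[mu]_(t in `[0, +oo[) u n t.
  rewrite -Rintegral_mkcondr; congr (Rintegral _ _ _).
  rewrite setIidr// => x /=; rewrite !in_itv/= andbT => /andP[->]//.
under eq_fun do rewrite uE.
have mf : measurable_fun (`[0%R, +oo[ : set R) f by move/measurable_int/measurable_EFinP : fi.
have [||||_ //] := @Rdominated_convergence _ (`[0%R, +oo[%classic : set R)
    u f (fun t => `|f t|) (measurable_itv _).
- move=> n; apply/measurable_restrict => //.
  by apply: measurable_funS mf => //; exact: subIsetl.
- move=> t; rewrite /= in_itv/= andbT => t0.
  apply: cvg_near_cst; near=> n; rewrite /u patchE mem_set//= in_itv/= t0/=.
  by near: n; exact: nbhs_infty_ger.
- exact: integrable_norm fi.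
- by move=> n t _; rewrite /u patchE; case: ifPn; rewrite ?normr0.
Unshelve. all: by end_near. Qed.

Definition primitive f t : R := \int[mu]_(u in `[0, t]) f u.

Lemma within_continuous_integrable f t : {within `[0, +oo[, continuous f} ->
  mu.-integrable `[0, t] (EFin \o f).
Proof.
move=> cf; apply: continuous_compact_integrable; first exact: segment_compact.
by apply: continuous_subspaceW cf; exact: subset_itvl.
Qed.

Lemma within_continuous_gt0 f t : {within `[0, +oo[, continuous f} -> 0 < t ->
  {for t, continuous f}.
Proof.
by move=> /continuous_within_itvcyP[cf _] t0; apply: cf; rewrite in_itv/= t0.
Qed.

Lemma is_derive_primitive f t : {within `[0, +oo[, continuous f} -> 0 < t ->
  is_derive t 1 (primitive f) (f t).
Proof.
move=> cf t0; have tt1 : t < t + 1 by rewrite ltrDl.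
have [d1 d2] := continuous_FTC1_closed tt1 (within_continuous_integrable _ cf) t0
  (within_continuous_gt0 cf t0).
by apply: DeriveDef; rewrite // -derive1E.
Qed.

Lemma continuous_expRM (c : R) : continuous (fun t : R => expR (c * t)).
Proof.
move=> t; apply/differentiable_continuous/derivable1_diffP.
by case: (is_derive_expRM c t).
Qed.

Lemma primitive0 f : primitive f 0 = 0.
Proof. by rewrite /primitive set_itv1 Rintegral_set1. Qed.

Lemma primitive_continuous f : {within `[0, +oo[, continuous f} ->
  {within `[0, +oo[, continuous (primitive f)}.
Proof.
move=> cf; apply/continuous_within_itvcyP; split.
  move=> t; rewrite in_itv/= andbT => t0.
  apply/differentiable_continuous/derivable1_diffP.
  by case: (is_derive_primitive cf t0).
rewrite primitive0.
apply/cvg_at_right_filter.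
exact: (@parameterized_integral_cvg_left _ 0 1 _ ltr01
    (within_continuous_integrable _ cf)).
Qed.

(** On [0, t] one has 1 <= exp(p t) exp(- p u), so the absolute integral of f is
at most exp(p t) times the integral of exp(- p u) |f(u)| over the half-line. *)
Lemma primitive_bound f p l : 0 <= p -> {within `[0, +oo[, continuous f} ->
  has_laplace f p l ->
  exists2 C, 0 <= C & forall t, 0 <= t -> `|primitive f t| <= C * expR (p * t).
Proof.
move=> p0 cf [fi _]; exists (\int[mu]_(t in `[0, +oo[) `|expR (- (p * t)) * f t|).
  by apply: Rintegral_ge0.
move=> t t0; have ft := within_continuous_integrable t cf.
apply: le_trans (le_normr_Rintegral _ ft) _ => //.
have fi' := integrable_norm fi.
have sub : `[0, t] `<=` `[0%R, +oo[ by exact: subset_itvl.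
have fiC : mu.-integrable `[0, +oo[
    (EFin \o (fun u => `|expR (- (p * u)) * f u| * expR (p * t))).
  by have := integrableZr _ (expR (p * t)) fi' => /(_ (measurable_itv _)).
have fiCt : mu.-integrable `[0, t]
    (EFin \o (fun u => `|expR (- (p * u)) * f u| * expR (p * t))).
  by apply: integrableS fiC.
rewrite -RintegralZr//.
apply: (@le_trans _ _ (\int[mu]_(u in `[0, t]) (`|expR (- (p * u)) * f u| * expR (p * t)))).
  apply: le_Rintegral => //.
  - exact: integrable_norm.
  - move=> u /=; rewrite in_itv/= => /andP[u0 ut].
    rewrite normrM (ger0_norm (expR_ge0 _)) mulrAC -expRD ler_peMl//.
    by rewrite -[leLHS]expR0 ler_expR addrC subr_ge0 ler_wpM2l.
apply: fine_le.
- exact: integrable_fin_num fiCt.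
- exact: integrable_fin_num fiC.
- apply: ge0_subset_integral => //.
  exact: measurable_int fiC.
Qed.

(** Integrate the derivative exp(- p t) f - p exp(- p t) F of exp(- p t) F over
[0, n].  The smaller abscissa p' makes the boundary term vanish at infinity and
exp(- p t) F integrable, through primitive_bound. *)
Lemma has_laplace_primitive f p' p l' l : {within `[0, +oo[, continuous f} ->
  0 <= p' -> p' < p -> has_laplace f p' l' -> has_laplace f p l ->
  has_laplace (primitive f) p (l / p).
Proof.
move=> cf p'0 p'p fl' fl; have p0 : 0 < p by exact: le_lt_trans p'p.
have [C C0 FC] := primitive_bound p'0 cf fl'.
have mF : measurable_fun (`[0, +oo[ : set R) (primitive f).
  by apply: subspace_continuous_measurable_fun => //; exact: primitive_continuous.
have Fi : mu.-integrable `[0, +oo[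
    (fun t => (expR (- (p * t)) * primitive f t)%:E).
  have [i _] := has_laplace_expR C p'p.
  apply: le_integrable i => //.
    by apply/measurable_EFinP; exact: measurable_laplace_integrand.
  move=> t; rewrite /= in_itv/= andbT => t0.
  rewrite lee_fin !normrM (ger0_norm (expR_ge0 _)) ler_wpM2l ?expR_ge0//.
  by rewrite (ger0_norm C0) (ger0_norm (expR_ge0 _)) FC.
split => //; have [fi <-] := fl.
pose G t : R := expR (- (p * t)) * primitive f t.
pose k t : R := expR (- (p * t)) * f t - p * G t.
have pGi : mu.-integrable `[0, +oo[ (fun t => (p * G t)%:E).
  by have := integrableZl _ p Fi => /(_ (measurable_itv _)).
have ki : mu.-integrable `[0, +oo[ (EFin \o k).
  by have := integrableB _ fi pGi => /(_ (measurable_itv _)).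
suff k0 : \int[mu]_(t in `[0, +oo[) k t = 0.
  move: k0; rewrite RintegralB// RintegralZl// => /eqP.
  by rewrite subr_eq0 => /eqP ->; rewrite mulrC mulKf// gt_eqF.
have cE : {within `[0, +oo[, continuous (fun t : R => expR (- (p * t)))}.
  apply: continuous_subspaceT; under eq_fun do rewrite -mulNr.
  exact: continuous_expRM.
have cG : {within `[0, +oo[, continuous G}.
  by move=> z; apply: cvgM; [exact: cE|exact: primitive_continuous].
have ck : {within `[0, +oo[, continuous k}.
  move=> z; apply: cvgB; first by apply: cvgM; [exact: cE|exact: cf].
  by apply: cvgMr; exact: cG.
have dG t : 0 < t -> is_derive t 1 G (k t).
  move=> t0; have dF := is_derive_primitive cf t0.
  have -> : G = (fun t => expR (- p * t)) * primitive f.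
    by apply/funext => x; rewrite /G fctE mulNr.
  apply: (is_derive_eq (is_deriveM (is_derive_expRM (- p) t) dF)).
  by rewrite /GRing.scale/= /k /G mulNr; ring.
have kn n : \int[mu]_(t in `[0, n.+1%:R]) k t = G n.+1%:R.
  have n0 : 0 < n.+1%:R :> R by rewrite ltr0n.
  rewrite /Rintegral (@continuous_FTC2 _ k G)//.
  - by rewrite /= {2}/G primitive0 mulr0 subr0.
  - by apply: continuous_subspaceW ck; exact: subset_itvl.
  - split.
    + by move=> t; rewrite in_itv/= => /andP[t0 _]; case: (dG t t0).
    + by have /continuous_within_itvcyP[] := cG.
    + apply/cvg_at_left_filter/differentiable_continuous/derivable1_diffP.
      by case: (dG _ n0).
  - move=> t; rewrite in_itv/= => /andP[t0 _]; rewrite derive1E.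
    by have := dG t t0 => ?; exact: derive_val.
have := Rintegral_cvgy ki; rewrite -cvg_shiftS => /cvg_lim <-//.
apply: cvg_lim => //.
under eq_fun do rewrite kn.
apply/norm_cvg0P.
have : C * expR (- (p - p') * n.+1%:R) @[n --> \oo] --> (0 : R).
  rewrite -(mulr0 C); apply: cvgMr.
  apply: (@cvg_comp _ _ _ (fun n => n.+1%:R) (fun t => expR (- (p - p') * t)) _ +oo).
    by have := @cvgr_idn R; rewrite -cvg_shiftS.
  by apply: cvg_expRN; rewrite subr_gt0.
apply: squeeze_cvgr; last exact: cvg_cst.
apply: nearW => n; rewrite normr_ge0/= /G normrM (ger0_norm (expR_ge0 _)).
apply: le_trans (ler_wpM2l (expR_ge0 _) (FC _ _)) _; first by rewrite ler0n.
rewrite mulrCA -expRD le_eqVlt; apply/orP; left; apply/eqP.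
by congr (_ * expR _); ring.
Qed.

End primitive.

(** * Injectivity of the Laplace transform *)

Section lerch.
Variable R : realType.
Implicit Types (g : R -> R) (p l t T : R).
Notation mu := (@lebesgue_measure R).

Lemma has_laplace_norm g p l : has_laplace g p l ->
  exists m, has_laplace (fun t => `|g t|) p m.
Proof.
move=> [gi _]; eexists; split; last reflexivity.
apply: eq_integrable (integrable_norm gi) => // t _ /=.
by rewrite normrM ger0_norm ?expR_ge0.
Qed.

Lemma exp_partial_le (y : R) K :
  `|\sum_(0 <= k < K) exp_coeff (- y) k| <= expR `|y|.
Proof.
apply: le_trans (ler_norm_sum _ _ _) _.
rewrite /expR; apply: (@le_trans _ _ (series (exp_coeff `|y|) K)).
  apply: ler_sum => k _.
  by rewrite /exp_coeff/= normrM normfV normrX normrN normr_nat.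
apply: nondecreasing_cvgn_le; last exact: is_cvg_series_exp_coeff.
apply/nondecreasing_seqP => n; rewrite /series/= big_nat_recr//= lerDl.
by rewrite /exp_coeff/= divr_ge0// exprn_ge0.
Qed.

(** Expand the outer exponential in powers of exp(- a t): the k-th term is a
multiple of exp(- a k t) g, whose transform at s is that of g at s + a k. *)
Lemma laplace0_phragmen g p0 s a T : (forall p, p0 < p -> has_laplace g p 0) ->
  p0 < s -> 0 <= a ->
  has_laplace (fun t => expR (- (T * expR (- (a * t)))) * g t) s 0.
Proof.
move=> g0 ps a0.
have [m gm] := has_laplace_norm (g0 s ps).
apply: (@has_laplace_lim _ (fun K t =>
    (\sum_(0 <= k < K) exp_coeff (- (T * expR (- (a * t)))) k) * g t) (fun=> 0) _
    (fun t => expR `|T| * `|g t|) _ _ (expR `|T| * m)).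
- move=> K; have := has_laplace_sum (index_iota 0 K) (fun k =>
    has_laplaceZ ((- T) ^+ k / k`!%:R) (has_laplace_shift (g0 (s + a * k%:R) _))).
  have ask k : p0 < s + a * k%:R by rewrite (lt_le_trans ps)// lerDl mulr_ge0.
  move=> /(_ ask); rewrite big1; last by move=> k _; rewrite mulr0.
  apply: eq_has_laplace => t _; rewrite mulr_suml; apply: eq_bigr => k _.
  have -> : - (a * k%:R * t) = k%:R * - (a * t) by ring.
  rewrite expRM_natl /exp_coeff/= -[X in _ = X ^+ k / _ * _]mulNr exprMn.
  by rewrite mulrA; congr (_ * _); rewrite mulrAC.
- move=> t t0; apply: cvgMl; exact: is_cvg_series_exp_coeff.
- exact: has_laplaceZ gm.
- move=> K t t0; rewrite normrM ler_wpM2r//.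
  apply: le_trans (exp_partial_le _ _) _; rewrite ler_expR normrM.
  rewrite (ger0_norm (expR_ge0 _)) ler_piMr// -[X in _ <= X]expR0 ler_expR.
  by rewrite oppr_le0 mulr_ge0.
- exact: cvg_cst.
Unshelve. all: by end_near. Qed.

(** The previous lemma with factor exp(- exp(n^2 (T - t) + n)), which tends to 1
if t > T and to 0 otherwise; the extra n settles the case t = T. *)
Lemma laplace0_tail g p0 s T : (forall p, p0 < p -> has_laplace g p 0) ->
  p0 < s -> has_laplace (fun t => (T < t)%R%:R * g t) s 0.
Proof.
move=> g0 ps.
have [m gm] := has_laplace_norm (g0 s ps).
pose A (n : nat) : R := n%:R ^+ 2.
pose u (n : nat) t := expR (- (expR (A n * T + n%:R) * expR (- (A n * t)))) * g t.
apply: (@has_laplace_lim _ u (fun=> 0) _ (fun t => `|g t|) _ _ m) => //.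
- by move=> n; apply: laplace0_phragmen g0 ps _; rewrite /A exprn_ge0.
- move=> t t0; rewrite /u; apply: cvgMl.
  under eq_fun do rewrite -expRD.
  have [Tt|tT] := ltP T t.
    have -> : true%:R = expR (- 0) :> R by rewrite oppr0 expR0.
    apply: (@continuous_cvg _ _ _ _ _ (fun n => - expR (A n * T + n%:R - A n * t)) expR).
      exact: continuous_expR.
    apply: cvgN; apply: (squeeze_cvgr _ (cvg_cst _)); last exact: cvgn_expR.
    have d0 : 0 < t - T by rewrite subr_gt0.
    near=> n; rewrite expR_ge0 ler_expR.
    have : 2 / (t - T) <= n%:R by near: n; exact: nbhs_infty_ger.
    rewrite ler_pdivrMr// => nd; rewrite /A.
    have := ler_wpM2l (ler0n R n) nd; nra.
  apply: (squeeze_cvgr _ (cvg_cst _)); last exact: cvgn_expR.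
  apply: nearW => n; rewrite expR_ge0 ler_expR lerN2.
  apply: le_trans (expR_ge1Dx _); rewrite /A.
  have : 0 <= n%:R ^+ 2 * (T - t) by rewrite mulr_ge0 ?exprn_ge0 ?subr_ge0.
  lra.
- move=> n t t0; rewrite /u normrM ger0_norm ?expR_ge0//.
  apply: ler_piMl => //; rewrite -[X in _ <= X]expR0 ler_expR oppr_le0 mulr_ge0.
- exact: cvg_cst.
Unshelve. all: by end_near. Qed.

(** By laplace0_tail the integral of exp(- s u) g(u) over every [0, T] vanishes;
differentiate with respect to T. *)
Lemma laplace_eq0 g p0 : (forall p, p0 < p -> has_laplace g p 0) ->
  (forall t, 0 < t -> {for t, continuous g}) ->
  forall t, 0 < t -> g t = 0.
Proof.
move=> g0 cg t t0; pose s := p0 + 1.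
have ps : p0 < s by rewrite ltrDl.
pose w t : R := expR (- (s * t)) * g t.
have [wi w0] := g0 s ps.
have W0 T : \int[mu]_(u in `[0, T]) w u = 0.
  have [ti t00] := laplace0_tail T g0 ps.
  have := RintegralB _ wi ti => /(_ (measurable_itv _)).
  rewrite w0 t00 subr0; apply: etrans.
  have -> : [set` `[0, T]] = `[0, +oo[ `&` [set u | u <= T].
    by apply/seteqP; split=> x /=; rewrite !in_itv/= andbT => /andP.
  rewrite Rintegral_mkcondr; apply: eq_Rintegral => x _.
  rewrite patchE; case: ifPn; rewrite ?inE/= ?notin_setE/=.
    by move=> xT; rewrite ltNge xT/= mul0r mulr0 subr0.
  by move/negP; rewrite -ltNge => ->; rewrite mul1r subrr.
have tt1 : t < t + 1 by rewrite ltrDl.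
have wi1 : mu.-integrable `[0, t + 1] (EFin \o w).
  by apply: integrableS wi => //; exact: subset_itvl.
have cw : {for t, continuous w}.
  apply: cvgM; last exact: cg.
  under eq_fun do rewrite -mulNr.
  by rewrite -mulNr; exact: continuous_expRM.
have [_] := continuous_FTC1_closed tt1 wi1 t0 cw.
have -> : (fun x => \int[mu]_(t in `[0, x]) w t) = cst 0 by apply/funext.
rewrite derive1_cst => /esym/eqP; rewrite /w mulf_eq0 gt_eqF ?expR_gt0//=.
by move/eqP.
Qed.

End lerch.

(** * Expected number of events *)

Section real_restriction.
Variable R : realType.
Implicit Types (g : R -> R) (p l x b : R).

Lemma cpow_real x b : 0 < x -> cpow x%:C b = (x `^ b)%:C.
Proof.
move=> x0; rewrite /cpow /clog /carg/= expr0n/= addr0 sqrtr_sqr gtr0_norm//.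
rewrite lexx divff ?gt_eqF// acos1 /cexp.
rewrite /= mul0r mulr0 mul0r subr0 addr0.
by rewrite cos0 sin0 mulr1 mulr0 /powR gt_eqF.
Qed.

Lemma has_laplace_real g p l : laplace_integrable g p%:C ->
  laplace g p%:C = l%:C -> has_laplace g p l.
Proof.
move=> gi [gl _]; split => //; rewrite -gl; apply: eq_Rintegral => t _.
by rewrite !(mulr0, mul0r, addr0, oppr0) cos0 mulr1.
Qed.

(** The identity is the primitive of 1. *)
Lemma has_laplace_id p : 0 < p -> has_laplace (fun x : R => x) p (p^-1 / p).
Proof.
move=> p0; have p20 : 0 < p / 2 by rewrite divr_gt0.
have c1 : {within `[0, +oo[, continuous (fun _ : R => 1 : R)}.
  by apply: continuous_subspaceT => x; exact: cst_continuous.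
have p2p : p / 2 < p by lra.
have mE (x : R) : 0 <= x -> fine (@lebesgue_measure R `[0%R, x]) = x.
  rewrite lebesgue_measure_itv/= lte_fin => x0.
  by case: ltP => [_|]; [rewrite /= subr0|move=> ?; apply/le_anti/andP].
have := has_laplace_primitive c1 (ltW p20) p2p (has_laplace1 p20) (has_laplace1 p0).
apply: eq_has_laplace => x x0; rewrite /primitive Rintegral_cst// mul1r.
exact: mE.
Qed.

End real_restriction.
Theorem mainTheorem3 (R : realType) (d : measure_display)
    (T : measurableType d) (P : probability T R)
    (Lambda0 alpha gamma beta nu : R)
    (f : R -> R) (N : T -> cumulative R R) (lambda : R -> R)
    (Lambda0_gt0 : 0 < Lambda0) (alpha_gt0 : 0 < alpha) (gamma_gt0 : 0 < gamma)
    (beta_gt0 : 0 < beta) (beta_lt1 : beta < 1) (nu_gt0 : 0 < nu)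
    (nondeg : (alpha - 1) * gamma + nu `^ beta != 0)
    (kernel_f : tempered_ML_kernel gamma beta nu f)
    (hawkes_N : hawkes_process P N Lambda0 alpha f)
    (lambdaE : forall t, 0 <= t ->
       ('E_P[intensity N Lambda0 alpha f t] = (lambda t)%:E)%E)
    (lambda_cont : {within `[0, +oo[, continuous lambda})
    (lambda_laplace : exists s0 : R, forall s : R[i], s0 < complex.Re s ->
       laplace_integrable lambda s /\
       laplace lambda s =
         Lambda0%:C / s *
         ((gamma%:C - (nu `^ beta)%:C + cpow (nu%:C + s) beta) /
          ((gamma * (1 - alpha))%:C - (nu `^ beta)%:C + cpow (nu%:C + s) beta)))
    (EN_lambda : forall t, 0 <= t ->
       ('E_P[fun w => N w t] =
         \int[@lebesgue_measure R]_(u in `[0%R, t]) (lambda u)%:E)%E)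
    (t : R) (t_ge0 : 0 <= t) :
  let c := (alpha - 1) * gamma + nu `^ beta in
  let a (m n : nat) := nu ^+ (n + m) * t ^+ (m + n + 1) *
    mittag_leffler 1 beta (m + n + 2)%:R (c * t `^ beta) in
  [/\ forall m n : nat,
        cvgn (series
          (mittag_leffler_term 1 beta (m + n + 2)%:R (c * t `^ beta))),
      forall m : nat, cvgn (series (a m)),
      cvgn (series (fun m => limn (series (a m)))) &
      ('E_P[fun w => N w t])%E =
        (Lambda0 * ((nu `^ beta - gamma) / c * t +
                    alpha * gamma * expR (- (nu * t)) / c *
                    (limn (series (fun m => limn (series (a m)))))))%:E].
Proof.
move=> c a.
have c0 : c != 0 := nondeg.
have nu0 : 0 <= nu by exact: ltW.
have [B [B1 Bnu Bc]] := exponential_type_exists beta_gt0 c nu0.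
have B0 : 0 < B by exact: lt_le_trans B1.
have [s0 Hs0] := lambda_laplace.
pose p0 := Num.max s0 B.
have p0B p : p0 < p -> s0 < p /\ B < p by rewrite gt_max => /andP.
have nupB p : p0 < p -> B < p + nu.
  by move=> /p0B[_ Bp]; rewrite (lt_le_trans Bp)// lerDl.
have D0 p : B < p -> 0 < p `^ beta - c.
  move=> Bp; have Bb0 : 0 < B `^ beta by exact: powR_gt0.
  have := @ge0_ler_powR _ _ (ltW beta_gt0) B p; rewrite !nnegrE.
  move=> /(_ (ltW B0) (ltW (lt_trans B0 Bp)) (ltW Bp)).
  have := ler_norm c; lra.
have lamL p : p0 < p ->
    has_laplace lambda p (Lambda0 / p * (1 + alpha * gamma / ((p + nu) `^ beta - c))).
  move=> pp; have [sp Bp] := p0B _ pp; have pnu0 : 0 < p + nu.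
    by rewrite addr_gt0// (lt_trans B0).
  have [li lE] := Hs0 p%:C sp; apply: has_laplace_real => //; rewrite lE.
  have -> : nu%:C + p%:C = (p + nu)%:C by rewrite -rmorphD addrC.
  rewrite cpow_real//.
  have /gt_eqF/negbT Dp := D0 _ (nupB _ pp).
  rewrite -!rmorphB -!rmorphD -!fmorphV -!rmorphM; congr (_%:C).
  have E : gamma * (1 - alpha) - nu `^ beta + (p + nu) `^ beta = (p + nu) `^ beta - c.
    by rewrite /c; ring.
  rewrite E; congr (_ * _).
  have -> : gamma - nu `^ beta + (p + nu) `^ beta = ((p + nu) `^ beta - c) + alpha * gamma.
    by rewrite /c; ring.
  by rewrite mulrDl divff.
pose EN := primitive lambda.
have ENL p : p0 < p -> has_laplace EN p
    (Lambda0 / p * (1 + alpha * gamma / ((p + nu) `^ beta - c)) / p).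
  move=> pp; have mid : p0 < (p0 + p) / 2 by lra.
  apply: (@has_laplace_primitive _ _ ((p0 + p) / 2) _ _ _ lambda_cont); last exact: lamL.
  - by apply: ltW; apply: lt_trans mid; rewrite lt_max B0 orbT.
  - by lra.
  - exact: lamL mid.
pose F x : R := Lambda0 * ((nu `^ beta - gamma) / c * x +
  alpha * gamma / c * (expR (- (nu * x)) * ml_sum beta nu c x)).
have FL p : p0 < p -> has_laplace F p
    (Lambda0 / p * (1 + alpha * gamma / ((p + nu) `^ beta - c)) / p).
  move=> pp; have [sp Bp] := p0B _ pp; have p_gt0 : 0 < p by exact: lt_trans Bp.
  have /gt_eqF/negbT Dp := D0 _ (nupB _ pp).
  have := has_laplaceZ Lambda0 (has_laplaceD
    (has_laplaceZ ((nu `^ beta - gamma) / c) (has_laplace_id p_gt0))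
    (has_laplaceZ (alpha * gamma / c) (has_laplace_shift
       (has_laplace_ml_sum beta_gt0 nu0 B1 Bnu Bc (nupB _ pp))))).
  congr (has_laplace _ _ _).
  (* the coefficient of the linear term is 1 - alpha gamma / c *)
  have -> : nu `^ beta - gamma = c - alpha * gamma by rewrite /c; ring.
  rewrite addrK; field.
  by rewrite c0 Dp gt_eqF.
have dL p : p0 < p -> has_laplace (fun x => EN x + (-1) * F x) p 0.
  move=> pp; have := has_laplaceD (ENL _ pp) (has_laplaceZ (-1) (FL _ pp)).
  by rewrite mulN1r subrr.
have cF x : 0 < x -> {for x, continuous F}.
  move=> x0; apply: cvgMr; apply: cvgD; first by apply: cvgMr; exact: cvg_id.
  apply: cvgMr; apply: cvgM; last exact: ml_sum_continuous.
  by under eq_fun do rewrite -mulNr; rewrite -mulNr; exact: continuous_expRM.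
have cEN x : 0 < x -> {for x, continuous EN}.
  by move=> x0; apply: within_continuous_gt0 => //; exact: primitive_continuous.
have ENF : EN t = F t.
  move: t_ge0; rewrite le_eqVlt => /predU1P[<-|t_gt0].
    by rewrite /EN primitive0 /F ml_sum0// !mulr0 addr0 mulr0.
  have cD x : 0 < x -> {for x, continuous (fun x => EN x + (-1) * F x)}.
    by move=> x0; apply: cvgD; [exact: cEN|apply: cvgMr; exact: cF].
  have H := laplace_eq0 dL cD t_gt0.
  by apply/eqP; rewrite -subr_eq0 -mulN1r; apply/eqP; exact: H.
have [aC SC _ _] := ml_sum_box beta_gt0 nu0 B1 Bnu Bc t_ge0.
split => //.
- by move=> m n; exact: is_cvg_mittag_leffler.
rewrite EN_lambda//.
have lt := within_continuous_integrable t lambda_cont.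
rewrite -[LHS]fineK; last exact: integrable_fin_num lt.
congr EFin; rewrite -/(Rintegral _ _ _) -/(primitive lambda t) -/(EN t) ENF /F.
have -> : ml_sum beta nu c t = limn (series (fun m => limn (series (a m)))) by [].
by set S := limn _; congr (_ * (_ + _)); ring.
Qed.
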